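(* Let $m\ge2$ and $n\ge1$ be integers and let $\mathcal{A}$ be a real tensor of order $m$ and dimension $n$. Then $\mathcal{A}$ is centrosymmetric if and only if $\mathcal{A}J=J\mathcal{A}$; and $\mathcal{A}$ is skew centrosymmetric if and only if $\mathcal{A}J=-J\mathcal{A}$.
   Context: Write $[n]=\{1,\dots,n\}$. A real tensor of order $m$ and dimension $n$ is an array $\mathcal{A}=(a_{i_1\cdots i_m})$ of reals with $i_1,\dots,i_m\in[n]$. It is centrosymmetric if $a_{i_1\cdots i_m}=a_{n-i_1+1,\dots,n-i_m+1}$ for all indices, and skew centrosymmetric if $a_{i_1\cdots i_m}=-a_{n-i_1+1,\dots,n-i_m+1}$ for all indices. $J$ is the $n\times n$ real matrix with $J_{ij}=\delta_{i,\,n-j+1}$ (the exchange matrix; $\delta$ is the Kronecker delta). Tensor product: for $\mathcal{A}$ of order $m\ge2$ and $\mathcal{B}$ of order $k\ge1$, both of dimension $n$, $\mathcal{A}\mathcal{B}$ has order $(m-1)(k-1)+1$ and entries $(\mathcal{A}\mathcal{B})_{i\alpha_1\cdots\alpha_{m-1}}=\sum_{i_2,\dots,i_m\in[n]}a_{i i_2\cdots i_m}b_{i_2\alpha_1}\cdots b_{i_m\alpha_{m-1}}$ with $i\in[n]$, $\alpha_j\in[n]^{k-1}$. In particular, regarding $J$ as an order 2 tensor, $(J\mathcal{A})_{i_1\cdots i_m}=\sum_{j\in[n]}J_{i_1j}a_{ji_2\cdots i_m}$ and $(\mathcal{A}J)_{i_1\cdots i_m}=\sum_{j_2,\dots,j_m\in[n]}a_{i_1j_2\cdots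 j_m}J_{j_2i_2}\cdots J_{j_mi_m}$. *)

(* Defs.v *)
From HB Require Import structures.
From mathcomp Require Import all_boot all_order all_algebra.
From mathcomp Require Import reals.

Set Implicit Arguments.
Unset Strict Implicit.
Unset Printing Implicit Defensive.

Import GRing.Theory.
Local Open Scope ring_scope.

(* Indices are 0-based: [n] = {1, .., n} is 'I_n, and the reflection
   i |-> n - i + 1 is rev_ord. *)
Definition tensor (R : Type) (m n : nat) := {ffun m.-tuple 'I_n -> R}.

HB.instance Definition _ (R : zmodType) (m n : nat) :=
  GRing.Zmodule.on (tensor R m n).

Definition centrosymmetric (R : Type) m n (A : tensor R m n) : Prop :=
  forall t : m.-tuple 'I_n, A t = A (map_tuple (@rev_ord n) t).

Definition skew_centrosymmetric (R : zmodType) m n (A : tensor R m n) : Prop :=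
  forall t : m.-tuple 'I_n, A t = - A (map_tuple (@rev_ord n) t).

Definition exchange_mx (R : pzRingType) n : 'M[R]_n :=
  \matrix_(i, j) (i == rev_ord j)%:R.

Definition tensor_of_mx (R : Type) n (M : 'M[R]_n) : tensor R 2 n :=
  [ffun t => M (tnth t ord0) (tnth t ord_max)].

Lemma block_subproof m k (l : 'I_m) (r : 'I_k) : (l * k + r < m * k)%N.
Proof.
apply: (@leq_trans (l.+1 * k)%N); first by rewrite mulSn addnC ltn_add2r.
by rewrite leq_mul2r ltn_ord orbT.
Qed.

(* The l-th of the m consecutive blocks of length k that make up s. *)
Definition block (T : Type) m k (s : (m * k).-tuple T) (l : 'I_m) : k.-tuple T :=
  [tuple tnth s (Ordinal (block_subproof l r)) | r < k].

(* The factors have orders m.+1 and k.+1, so that the order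
   ((m.+1) - 1) * ((k.+1) - 1) + 1 of the product is (m * k).+1; the index t of
   an entry is i alpha_1 .. alpha_m, where alpha_l = block (behead_tuple t) l. *)
Definition tensor_mul (R : pzRingType) m k n
    (A : tensor R m.+1 n) (B : tensor R k.+1 n) : tensor R (m * k).+1 n :=
  [ffun t => \sum_(j : m.-tuple 'I_n)
     A (cons_tuple (thead t) j) *
     \prod_(l < m) B (cons_tuple (tnth j l) (block (behead_tuple t) l))].

(* Transport along an equality of orders: (m * 1).+1 and (1 * m).+1 are equal to
   m.+1, but not convertible to it. *)
Definition cast_tensor (R : Type) m m' n (e : m = m') (A : tensor R m n) :
    tensor R m' n :=
  [ffun t => A (tcast (esym e) t)].

Definition tensor_mulJ (R : pzRingType) m n (A : tensor R m.+1 n) :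
    tensor R m.+1 n :=
  cast_tensor (congr1 S (muln1 m))
    (tensor_mul A (tensor_of_mx (exchange_mx R n))).

Definition tensor_Jmul (R : pzRingType) m n (A : tensor R m.+1 n) :
    tensor R m.+1 n :=
  cast_tensor (congr1 S (mul1n m))
    (tensor_mul (tensor_of_mx (exchange_mx R n)) A).

(* Main.v *)
(** Contracting with the exchange matrix only reflects indices: [A J] reflects
    every index of [A] but the first, and [J A] reflects the first one alone.
    Reflecting is an involution, so [A J = c J A] for a sign [c] amounts to
    [A t = c A (rev t)] for all [t]. *)
Require Import Defs.
From mathcomp Require Import all_boot all_order all_algebra.
From mathcomp Require Import reals.

Import GRing.Theory.
Local Open Scope ring_scope.

Lemma tensor_exchangeE (R : pzRingType) (n : nat) (i : 'I_n) (s : 1.-tuple 'I_n) :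
  tensor_of_mx (exchange_mx R n) (cons_tuple i s) = (i == rev_ord (thead s))%:R.
Proof.
rewrite ffunE mxE tnth0; congr (_ == rev_ord _)%:R.
by rewrite /thead !(tnth_nth i).
Qed.

(** The product of Kronecker deltas kills every summand but the one at the reflected tail.
    Commutativity of [R] allows any single factor to be pulled out of that product. *)
Lemma tensor_mulJE (R : comPzRingType) (m n : nat) (A : tensor R m.+1 n)
    (i : 'I_n) (s : m.-tuple 'I_n) :
  tensor_mulJ A (cons_tuple i s) =
  A (cons_tuple i (map_tuple (@rev_ord n) s)).
Proof.
rewrite !ffunE; set t := tcast _ _.
have t0 : thead t = i by rewrite /thead tcastE !(tnth_nth i).
(* Blocks have length 1 here, and the cast keeps the underlying sequence. *)
have tblock (l : 'I_m) : thead (block (behead_tuple t) l) = tnth s l.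
  rewrite /thead tnth_mktuple !(tnth_nth i) /= val_tcast /=.
  by rewrite muln1 addn0.
under eq_bigr => j _ do
  (under eq_bigr => l _ do rewrite tensor_exchangeE tblock).
rewrite (bigD1 (map_tuple (@rev_ord n) s)) //= t0 !big1 ?addr0 ?mulr1 //.
  move=> j /eqP neq_js.
  (* A position where [j] differs from the reflection of [s] gives a zero factor. *)
  have [l neq_l] : exists l, tnth j l != rev_ord (tnth s l).
    apply/existsP; apply: contra_notT neq_js; rewrite negb_exists => /forallP eq_js.
    by apply: eq_from_tnth => l; rewrite tnth_map; apply/eqP/negPn.
  by rewrite (bigD1 l) //= (negPf neq_l) mul0r mulr0.
by move=> l _; rewrite tnth_map eqxx.
Qed.

(** The sum runs over 1-tuples, and the only block is the whole tail [s]; the delta selects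
    [rev_ord i]. *)
Lemma tensor_JmulE (R : pzRingType) (m n : nat) (A : tensor R m.+1 n)
    (i : 'I_n) (s : m.-tuple 'I_n) :
  tensor_Jmul A (cons_tuple i s) = A (cons_tuple (rev_ord i) s).
Proof.
rewrite !ffunE; set t := tcast _ _.
have t0 : thead t = i by rewrite /thead tcastE !(tnth_nth i).
have tblock : block (behead_tuple t) ord0 = s.
  apply: eq_from_tnth => r; rewrite tnth_mktuple !(tnth_nth i) /= val_tcast /=.
  by rewrite mul0n add0n.
under eq_bigr => j _ do rewrite tensor_exchangeE big_ord1 tblock t0.
rewrite (bigD1 [tuple rev_ord i]) //= big1 => [|j neq_j].
  by rewrite rev_ordK eqxx mul1r addr0.
case: eqP => [def_i|_]; last by rewrite mul0r.
case/eqP: neq_j; rewrite def_i rev_ordK.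
by apply: eq_from_tnth => r; rewrite (ord1 r).
Qed.

Lemma map_rev_ordK (m n : nat) :
  involutive (@map_tuple m 'I_n 'I_n (@rev_ord n)).
Proof. by move=> s; apply: val_inj; rewrite /= (mapK rev_ordK). Qed.

(** The map [f] stands for the sign: [id] gives the centrosymmetric case, [-%R] the skew one. The
    two conditions differ by the change of variable that reflects the tail of [t]. *)
Lemma reflection_tensor_mulJ (R : comPzRingType) (m n : nat)
    (A : tensor R m.+1 n) (f : R -> R) :
  (forall t, A t = f (A (map_tuple (@rev_ord n) t))) <->
  (forall t, tensor_mulJ A t = f (tensor_Jmul A t)).
Proof.
have map_cons i (s : m.-tuple 'I_n) :
    map_tuple (@rev_ord n) (cons_tuple i s) =
    cons_tuple (rev_ord i) (map_tuple (@rev_ord n) s) by exact: val_inj.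
split=> A_f t; case/tupleP: t => i s.
  by rewrite tensor_mulJE tensor_JmulE A_f map_cons map_rev_ordK.
(* The hypothesis is used at [i] followed by the reflection of [s]. *)
rewrite map_cons -tensor_JmulE -A_f.
by rewrite tensor_mulJE map_rev_ordK.
Qed.

Theorem theorem3p4 (R : realType) (m n : nat) (hm : (2 <= m.+1)%N)
    (hn : (1 <= n)%N) (A : tensor R m.+1 n) :
  (centrosymmetric A <-> tensor_mulJ A = tensor_Jmul A) /\
  (skew_centrosymmetric A <-> tensor_mulJ A = - tensor_Jmul A).
Proof.
have [AJ JA] := reflection_tensor_mulJ _ _ _ A id.
have [skewAJ skewJA] := reflection_tensor_mulJ _ _ _ A -%R.
split; split=> [A_sym | eqAJ].
- by apply/ffunP; apply: AJ.
- by apply: JA => t; rewrite eqAJ.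
- by apply/ffunP => t; rewrite [RHS]ffunE; apply: skewAJ.
- by apply: skewJA => t; rewrite eqAJ [LHS]ffunE.
Qed.
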